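(* Let $t$ be a positive integer and let $G_1$, $G_2$ be commutative Krasner $(m,n)$-hyperrings with scalar identities $1_{G_1}$, $1_{G_2}$. Let $\delta_1$ and $\delta_2$ be hyperideal expansions of $G_1$ and $G_2$ respectively, and let $\delta$ be a hyperideal expansion of $G_1\times G_2$ such that $\delta(Q_1\times Q_2)=\delta_1(Q_1)\times\delta_2(Q_2)$ for all hyperideals $Q_1$ of $G_1$ and $Q_2$ of $G_2$. If $Q=Q_1\times G_2$ (with $Q_1$ a hyperideal of $G_1$) is a weakly $(t,n)$-absorbing $\delta$-semiprimary hyperideal of $G_1\times G_2$, then it is a $(t,n)$-absorbing $\delta$-semiprimary hyperideal of $G_1\times G_2$.
   Context: Notation: $a_i^j$ is the sequence $a_i,a_{i+1},\dots,a_j$ (empty if $j<i$), $a^{(r)}$ is $a$ repeated $r$ times; $m,n\ge 2$ are integers. A Krasner $(m,n)$-hyperring $(G,h,k)$ consists of a set $G$, an $m$-ary hyperoperation $h$ (with values nonempty subsets of $G$, extended to subsets by unions) and an $n$-ary operation $k:G^n\to G$ such that: (1) $(G,h)$ is a canonical $m$-ary hypergroup, i.e. $h$ is associative and invariant under permutation of its arguments, there is a unique element $0$ with $h(x,0^{(m-1)})=\{x\}$ for all $x$, each $x$ has a unique $-x$ with $0\in h(x,-x,0^{(m-2)})$, and $x\in h(x_1^m)$ implies $x_i\in h(x,-x_1,\dots,-x_{i-1},-x_{i+1},\dots,-x_m)$ for each $i$; (2) $k$ is associative ($(G,k)$ is an $n$-ary semigroup); (3) $k(g_1^{i-1},h(x_1^m),g_{i+1}^n)=h(k(g_1^{i-1},x_1,g_{i+1}^n),\dots,k(g_1^{i-1},x_m,g_{i+1}^n))$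 for each $i$; (4) $k$ equals $0$ whenever one of its arguments is $0$. It is commutative if $k$ is invariant under permutation of its arguments; $1$ is a scalar identity if $k(x,1^{(n-1)})=x$ for all $x$. By iterating, $k$ is defined on any $l(n-1)+1$ elements, $l\ge 0$ (for $l=0$ the product of one element is that element); note $tn-t+1=t(n-1)+1$ and $(t-1)n-t+2=(t-1)(n-1)+1$. A hyperideal is a nonempty $I\subseteq G$ such that $(I,h)$ is an $m$-ary subhypergroup of $(G,h)$ (so $I$ is closed under $h$ and negatives) and $k(g_1^{i-1},I,g_{i+1}^n)\subseteq I$ for all $g_j\in G$ and all $i$. A hyperideal expansion of $G$ is a function $\delta$ from hyperideals to hyperideals of $G$ with $I\subseteq\delta(I)$, and $I\subseteq J$ implying $\delta(I)\subseteq\delta(J)$. The product $G_1\times G_2$ of Krasner $(m,n)$-hyperrings $(G_1,h_1,k_1)$, $(G_2,h_2,k_2)$ is the Krasner $(m,n)$-hyperring with $h((a_1,b_1),\dots,(a_m,b_m))=\{(a,b): a\in h_1(a_1^m),\,b\in h_2(b_1^m)\}$ and $k((a_1,b_1),\dots,(a_n,b_n))=(k_1(a_1^n),k_2(b_1^n))$. A proper hyperideal $Q$ of $G$ is $(t,n)$-absorbing $\delta$-semiprimary if whenever $k(a_1^{tn-t+1})\in Q$ for $a_1,\dots,a_{tn-t+1}\in G$, there exist $(t-1)n-t+2$ of the $a_i$'s (distinct indices) whose $k$-product is in $\delta(Q)$. It is weakly $(t,n)$-absorbing $\delta$-semiprimary if the same conclusion holds whenever $0\ne k(a_1^{tn-t+1})\in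 Q$.
   Formalization: The formal statement additionally assumes that the scalar identity of G_2 is different from 0 (G_2 is not the zero hyperring); without this the claim fails, e.g. for m=n=t=2, G_1=Z/8, G_2={0}, Q_1={0} and identity expansions. *)

(* Defs.v *)
From mathcomp Require Import all_boot perm.
From mathcomp Require Import boolp classical_sets.

Set Implicit Arguments.
Unset Strict Implicit.
Unset Printing Implicit Defensive.

Local Open Scope classical_set_scope.

(* A p-tuple of elements of T is a function 'I_p -> T, indices starting at 0. *)

(* The p-tuple s_1, ..., s_r, d, ..., d:  pad d [:: x] is (x, d^(p-1)). *)
Definition pad (p : nat) (T : Type) (d : T) (s : seq T) : 'I_p -> T :=
  fun j => nth d s j.

(* The p-tuple a with its entry at i replaced by y. *)
Definition update (p : nat) (T : Type) (a : 'I_p -> T) (i : 'I_p) (y : T) :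
  'I_p -> T := fun j => if j == i then y else a j.

(* Out of x_0, ..., x_(2p-2), the block x_i, ..., x_(i+p-1), and the p-tuple
   obtained by replacing that block with the single entry y.  The entries of x
   beyond 2p-2 are never read. *)
Definition block (p : nat) (T : Type) (x : nat -> T) (i : 'I_p) : 'I_p -> T :=
  fun j => x (i + j).

Definition contract (p : nat) (T : Type) (x : nat -> T) (i : 'I_p) (y : T) :
  'I_p -> T :=
  fun j => if j < i then x j else if j == i then y else x (j + p.-1).

Record krasner_hyperring (m n : nat) := KrasnerHyperring {
  carrier :> Type;
  hop : ('I_m -> carrier) -> set carrier;
  kop : ('I_n -> carrier) -> carrier;
  hzero : carrier;
  hopp : carrier -> carrier;
  hop_neq0 : forall x, hop x !=set0;
  hopA : forall (x : nat -> carrier) (i j : 'I_m),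
    \bigcup_(y in hop (block x i)) hop (contract x i y) =
    \bigcup_(y in hop (block x j)) hop (contract x j y);
  hopC : forall (s : {perm 'I_m}) (x : 'I_m -> carrier), hop (x \o s) = hop x;
  hop0 : forall x, hop (pad hzero [:: x]) = [set x];
  hzero_unique : forall z, (forall x, hop (pad z [:: x]) = [set x]) -> z = hzero;
  hopN : forall x, hop (pad hzero [:: x; hopp x]) hzero;
  hopp_unique : forall x y, hop (pad hzero [:: x; y]) hzero -> y = hopp x;
  (* x is put at place i rather than in front, which is immaterial by hopC *)
  hop_reversible : forall (a : 'I_m -> carrier) (x : carrier) (i : 'I_m),
    hop a x -> hop (update (hopp \o a) i x) (a i);
  kopA : forall (x : nat -> carrier) (i j : 'I_n),
    kop (contract x i (kop (block x i))) = kop (contract x j (kop (block x j)));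
  kop_distr : forall (g : 'I_n -> carrier) (i : 'I_n) (x : 'I_m -> carrier),
    [set kop (update g i y) | y in hop x] =
    hop (fun j => kop (update g i (x j)));
  kop0 : forall (g : 'I_n -> carrier) (i : 'I_n), g i = hzero -> kop g = hzero
}.

Arguments hzero {m n} _.

Section Notions.
Context {m n : nat} {G : krasner_hyperring m n}.
Implicit Types (I Q : set G) (delta : set G -> set G).

Definition scalar_identity (e : G) : Prop := forall x : G, kop (pad e [:: x]) = x.

(* k iterated l times, k(... k(k(a_0, ..., a_(n-1)), a_n, ...) ...), on the
   l(n-1)+1 elements of a. *)
Fixpoint kprod (l : nat) : ('I_(l * n.-1).+1 -> G) -> G :=
  match l with
  | 0 => fun a => a ord0
  | l'.+1 => fun a =>
      kop (fun j : 'I_n => if j == 0 :> nat then kprod (l := l') (fun i => a (inord i))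
                           else a (inord (l' * n.-1 + j)))
  end.

(* Solvability of b \in h(a_1, ..., x_i, ..., a_m) inside I is the reproduction
   axiom of an m-ary hypergroup; with b = 0 it gives closure under hopp. *)
Definition subhypergroup I : Prop :=
  [/\ I !=set0,
      forall a : 'I_m -> G, (forall j, I (a j)) -> hop a `<=` I &
      forall (a : 'I_m -> G) (i : 'I_m) (b : G), (forall j, I (a j)) -> I b ->
        exists2 x, I x & hop (update a i x) b].

Definition hyperideal I : Prop :=
  subhypergroup I /\
  forall (g : 'I_n -> G) (i : 'I_n) (x : G), I x -> I (kop (update g i x)).

(* An expansion is carried by a map on all subsets; only its values on
   hyperideals are constrained, and only these are ever used. *)
Definition hyperideal_expansion delta : Prop :=
  [/\ forall I, hyperideal I -> hyperideal (delta I),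
      forall I, hyperideal I -> I `<=` delta I &
      forall I J, hyperideal I -> hyperideal J -> I `<=` J ->
        delta I `<=` delta J].

(* For t > 0, the family a has tn-t+1 = t(n-1)+1 members, of which
   (t-1)n-t+2 = (t-1)(n-1)+1 with distinct indices are selected by f. *)
Definition some_subproduct_in (t : nat) (a : 'I_(t * n.-1).+1 -> G) (S : set G) :
  Prop :=
  exists2 f : 'I_(t.-1 * n.-1).+1 -> 'I_(t * n.-1).+1,
    injective f & S (kprod (a \o f)).

Definition absorbing_semiprimary (t : nat) delta Q : Prop :=
  [/\ hyperideal Q, Q <> setT &
      forall a : 'I_(t * n.-1).+1 -> G,
        Q (kprod a) -> some_subproduct_in a (delta Q)].

Definition weakly_absorbing_semiprimary (t : nat) delta Q : Prop :=
  [/\ hyperideal Q, Q <> setT &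
      forall a : 'I_(t * n.-1).+1 -> G,
        kprod a <> hzero G -> Q (kprod a) -> some_subproduct_in a (delta Q)].

End Notions.

Definition commutative_hyperring (m n : nat) (G : krasner_hyperring m n) : Prop :=
  forall (s : {perm 'I_n}) (x : 'I_n -> G), kop (x \o s) = kop x.

Section Product.
Variables (m n : nat) (G1 G2 : krasner_hyperring m n).
Local Notation T := (G1 * G2)%type.

Let h (a : 'I_m -> T) : set T := hop (fst \o a) `*` hop (snd \o a).
Let k (a : 'I_n -> T) : T := (kop (fst \o a), kop (snd \o a)).
Let z : T := (hzero G1, hzero G2).
Let opp (x : T) : T := (hopp x.1, hopp x.2).

Let fst_pad p (d : T) s : fst \o pad (p := p) d s = pad d.1 (map fst s).
Proof.
apply: funext => j; rewrite /pad /=.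
have [js|js] := ltnP j (size s); first by rewrite (nth_map d).
by rewrite !nth_default ?size_map.
Qed.

Let snd_pad p (d : T) s : snd \o pad (p := p) d s = pad d.2 (map snd s).
Proof.
apply: funext => j; rewrite /pad /=.
have [js|js] := ltnP j (size s); first by rewrite (nth_map d).
by rewrite !nth_default ?size_map.
Qed.

Let fst_upd p (a : 'I_p -> T) i y : fst \o update a i y = update (fst \o a) i y.1.
Proof. by apply: funext => j; rewrite /update /=; case: ifP. Qed.

Let snd_upd p (a : 'I_p -> T) i y : snd \o update a i y = update (snd \o a) i y.2.
Proof. by apply: funext => j; rewrite /update /=; case: ifP. Qed.

Let fst_contract p (x : nat -> T) (i : 'I_p) y :
  fst \o contract x i y = contract (fst \o x) i y.1.
Proof. by apply: funext => j; rewrite /contract /=; case: ifP => // _; case: ifP. Qed.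

Let snd_contract p (x : nat -> T) (i : 'I_p) y :
  snd \o contract x i y = contract (snd \o x) i y.2.
Proof. by apply: funext => j; rewrite /contract /=; case: ifP => // _; case: ifP. Qed.

Let setX1 (A : set G1) (B : set G2) x y :
  A !=set0 -> B !=set0 -> A `*` B = [set (x, y)] -> A = [set x] /\ B = [set y].
Proof.
move=> [a Aa] [b Bb] /seteqP[AB _].
have HA c : A c -> c = x by move=> Ac; have [] := AB (c, b) (conj Ac Bb).
have HB c : B c -> c = y by move=> Bc; have [] := AB (a, c) (conj Aa Bc).
by split; apply/seteqP; split=> c /=; [exact: HA|move->; rewrite -(HA a)|
  exact: HB|move->; rewrite -(HB b)].
Qed.

Let h_neq0 x : h x !=set0.
Proof.
have [a Ha] := hop_neq0 (fst \o x); have [b Hb] := hop_neq0 (snd \o x).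
by exists (a, b).
Qed.

Let h_bigcup x (i : 'I_m) : \bigcup_(y in h (block x i)) h (contract x i y) =
  (\bigcup_(y in hop (block (fst \o x) i)) hop (contract (fst \o x) i y)) `*`
  (\bigcup_(y in hop (block (snd \o x) i)) hop (contract (snd \o x) i y)).
Proof.
apply/seteqP; split=> [[u v] [[a b] [/= Ha Hb]]|[u v] [[/= a Ha Hu] [b Hb Hv]]].
  by rewrite /h fst_contract snd_contract => -[/= Hu Hv]; split; [exists a|exists b].
by exists (a, b); [split|rewrite /h fst_contract snd_contract].
Qed.

Let hA x (i j : 'I_m) :
  \bigcup_(y in h (block x i)) h (contract x i y) =
  \bigcup_(y in h (block x j)) h (contract x j y).
Proof. by rewrite !h_bigcup (hopA _ i j) (hopA (snd \o x) i j). Qed.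

Let hC (s : {perm 'I_m}) x : h (x \o s) = h x.
Proof. by rewrite /h -(hopC s (fst \o x)) -(hopC s (snd \o x)). Qed.

Let h0 x : h (pad z [:: x]) = [set x].
Proof.
rewrite /h fst_pad snd_pad !hop0; apply/seteqP; case: x => a b.
by split=> [[u v] [/= -> ->]|_ ->].
Qed.

Let z_unique e : (forall x, h (pad e [:: x]) = [set x]) -> e = z.
Proof.
case: e => e1 e2 H.
suff [-> ->] : e1 = hzero G1 /\ e2 = hzero G2 by [].
by split; apply: hzero_unique => x;
  [have := H (x, hzero G2)|have := H (hzero G1, x)];
  rewrite /h fst_pad snd_pad /= => /setX1 []//; exact: hop_neq0.
Qed.

Let hN x : h (pad z [:: x; opp x]) z.
Proof. by rewrite /h fst_pad snd_pad; split; exact: hopN. Qed.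

Let opp_unique x y : h (pad z [:: x; y]) z -> y = opp x.
Proof.
rewrite /h fst_pad snd_pad => -[/hopp_unique y1 /hopp_unique y2].
by rewrite /opp -y1 -y2; case: y {y1 y2}.
Qed.

Let h_reversible a x (i : 'I_m) : h a x -> h (update (opp \o a) i x) (a i).
Proof.
by move=> [a1 a2]; rewrite /h fst_upd snd_upd; split; exact: hop_reversible.
Qed.

Let kA x (i j : 'I_n) :
  k (contract x i (k (block x i))) = k (contract x j (k (block x j))).
Proof.
rewrite /k !fst_contract !snd_contract /=.
by rewrite (kopA (fst \o x) i j) (kopA (snd \o x) i j).
Qed.

Let k_distr g (i : 'I_n) x :
  [set k (update g i y) | y in h x] = h (fun j => k (update g i (x j))).
Proof.
have -> : h (fun j => k (update g i (x j))) =
    [set kop (update (fst \o g) i y) | y in hop (fst \o x)] `*`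
    [set kop (update (snd \o g) i y) | y in hop (snd \o x)].
  rewrite !kop_distr; congr (hop _ `*` hop _); apply: funext => j /=.
  - by rewrite fst_upd.
  - by rewrite snd_upd.
apply/seteqP; split=> [_ [y [y1 y2] <-]|[_ _] [/= [a Ha <-] [b Hb <-]]].
  by rewrite /k fst_upd snd_upd; split; [exists y.1|exists y.2].
by exists (a, b); [split|rewrite /k fst_upd snd_upd].
Qed.

Let k0 g (i : 'I_n) : g i = z -> k g = z.
Proof. by move=> gi; rewrite /k !(kop0 (i := i))//= gi. Qed.

Definition prod_hyperring : krasner_hyperring m n :=
  KrasnerHyperring h_neq0 hA hC h0 z_unique hN opp_unique h_reversible kA
    k_distr k0.

End Product.

(* Main.v *)
Require Import Defs.
From mathcomp Require Import all_boot perm.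
From mathcomp Require Import boolp classical_sets.

Local Open Scope classical_set_scope.

(** Replace the second coordinate of every factor by the scalar identity of [G2].
The product of the modified factors keeps its first coordinate, hence stays in
[Q1 `*` setT], and has second coordinate [one2], hence is nonzero: the weak
hypothesis applies to it.  The selected subproduct lies in
[delta1 Q1 `*` delta2 setT] and has the same first coordinate as the subproduct
of the original factors with the same indices; the second coordinate is
unconstrained, since [delta2 setT] is everything.  Products are computed
coordinatewise by [kprod_pair], a product of copies of a scalar identity by
[kprod_identity]; [hyperideal_setT] is what allows the hypothesis on [delta] to
be applied to [Q1 `*` setT]. *)

Section Hyperring.
Context {m n : nat} {G : krasner_hyperring m n}.

Lemma hoppK (m_ge2 : 2 <= m) (x : G) : hopp (hopp x) = x.
Proof.
have m_gt0 : 0 < m by apply: leq_trans m_ge2.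
pose s := tperm (Ordinal m_gt0) (Ordinal m_ge2).
apply/esym/hopp_unique; rewrite -(hopC s).
suff -> : pad (hzero G) [:: hopp x; x] \o s = pad (hzero G) [:: x; hopp x].
  exact: hopN.
apply: funext => j; rewrite /pad /= /s.
case: tpermP => [->|->|/eqP j0 /eqP j1] //.
by case: j j0 j1 => [[|[|j]] hj] //=; rewrite -val_eqE.
Qed.

(** Reproduction in the whole hyperring: a solution of
[b \in h(a_1, ..., x, ..., a_m)] is any element of
[h(- a_1, ..., b, ..., - a_m)], by reversibility. *)
Lemma hyperideal_setT (m_ge2 : 2 <= m) : hyperideal [set: G].
Proof.
split=> //; split=> //; first by exists (hzero G).
move=> a i b _ _; set a' := update (fun j => hopp (a j)) i b.
have [c Hc] := hop_neq0 a'; exists c => //.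
have a'i : a' i = b by rewrite /a' /update eqxx.
have := hop_reversible i Hc; rewrite a'i.
suff -> : update (@hopp _ _ G \o a') i c = update a i c by [].
by apply: funext => j; rewrite /a' /update /=; case: eqP => // _; rewrite hoppK.
Qed.

Lemma kprod_identity (e : G) (l : nat) :
  scalar_identity e -> kprod (fun _ : 'I_(l * n.-1).+1 => e) = e.
Proof.
move=> eP; elim: l => [|l IHl] //=; rewrite IHl -[RHS]eP; congr kop.
by apply: funext => j; rewrite /pad; case: (nat_of_ord j) => [|[|k]].
Qed.

End Hyperring.

Lemma kprod_pair {m n : nat} {G1 G2 : krasner_hyperring m n} (l : nat)
    (a : 'I_(l * n.-1).+1 -> prod_hyperring G1 G2) :
  kprod a = (kprod (G := G1) (fun i => (a i).1),
             kprod (G := G2) (fun i => (a i).2)).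
Proof.
elim: l a => [|l IHl] a /=; first by case: (a ord0).
by congr (kop _, kop _); apply: funext => j /=; case: ifP; rewrite ?IHl.
Qed.

Theorem theorem2p37 (m n t : nat) (hm : 2 <= m) (hn : 2 <= n) (ht : 0 < t)
    (G1 G2 : krasner_hyperring m n)
    (G1C : commutative_hyperring G1) (G2C : commutative_hyperring G2)
    (one1 : G1) (one2 : G2)
    (one1P : scalar_identity one1) (one2P : scalar_identity one2)
    (one2_neq0 : one2 <> hzero G2)
    (delta1 : set G1 -> set G1) (delta2 : set G2 -> set G2)
    (delta : set (prod_hyperring G1 G2) -> set (prod_hyperring G1 G2))
    (delta1P : hyperideal_expansion delta1)
    (delta2P : hyperideal_expansion delta2)
    (deltaP : hyperideal_expansion delta)
    (delta_prod : forall (I1 : set G1) (I2 : set G2),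
       hyperideal I1 -> hyperideal I2 ->
       delta (I1 `*` I2) = delta1 I1 `*` delta2 I2)
    (Q1 : set G1) (Q1P : hyperideal Q1) :
  weakly_absorbing_semiprimary t delta (Q1 `*` [set: G2]) ->
  absorbing_semiprimary t delta (Q1 `*` [set: G2]).
Proof.
case=> QP Qproper Qweak; split=> // a; rewrite kprod_pair => -[/= Qa _].
pose b i : prod_hyperring G1 G2 := ((a i).1, one2).
have bE : kprod b = (kprod (fun i => (a i).1), one2).
  by rewrite kprod_pair (kprod_identity one2).
have [||f f_inj] := Qweak b.
- by rewrite bE => -[].
- by rewrite bE.
have setTP := hyperideal_setT (G := G2) hm.
rewrite (delta_prod _ _ Q1P setTP) kprod_pair => -[/= db _].
exists f => //; rewrite kprod_pair; split=> //=.
by have [_ sub _] := delta2P; exact: sub.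
Qed.
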